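(* Let $\mathcal{E}$ be a Boolean (elementary) topos and let $X\in\mathcal{E}_\star$. Then actions on $X$ in the semi-abelian category $\mathcal{E}_\star^{\mathrm{op}}$ are representable by $X$ itself; that is, there is a bijection $\mathrm{Act}(X,G)\cong\mathcal{E}_\star(X,G)$, natural in $G\in\mathcal{E}_\star$.
   Context: $\mathcal{E}_\star$ denotes the category of pointed objects of $\mathcal{E}$: objects are pairs $(A,\star\colon \mathbf{1}\to A)$ and morphisms preserve base points. It has a zero object $\mathbf{1}$; its dual $\mathcal{E}_\star^{\mathrm{op}}$ is a semi-abelian category. Kernels and cokernels are taken in $\mathcal{E}_\star$. Actions: everything is expressed in $\mathcal{E}_\star$ rather than in its dual. For $X,G\in\mathcal{E}_\star$, $\mathrm{Act}(X,G)$ (the set of $G$-actions on $X$ in $\mathcal{E}_\star^{\mathrm{op}}$) is the set of isomorphism classes of left-split short exact sequences in $\mathcal{E}_\star$, i.e. triples $(u,v,w)$ with $u\colon G\to A$, $v\colon A\to G$, $w\colon A\to X$ such that $u$ is a kernel of $w$, $w$ is a cokernel of $u$, and $vu=\mathrm{id}_G$. An isomorphism $(u,v,w)\cong(u',v',w')$ is an isomorphism $\theta\colon A\to A'$ with $\theta u=u'$, $v'\theta=v$, $w'\theta=w$. For fixed $X$, $\mathrm{Act}(X,-)\colon\mathcal{E}_\star\to\mathsf{Set}$ is a covariant functor: a morphism $s\colon G\to G'$ sends the class of $(u,v,w)$ to the class of the left-split exact sequence $G'\to A+_G G'\to X$ obtained by pushing out $u$ along $s$, with retraction $(sv,\mathrm{id}_{G'})$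 and cokernel map $(w,0)$. *)

(* Defs.v *)
(* Hom-types carry Leibniz equality, and universal properties are propositional. *)
From mathcomp Require Import ssreflect ssrfun ssrbool.
From Stdlib Require Import ProofIrrelevance PropExtensionality.
From Stdlib Require Import FunctionalExtensionality.

Set Implicit Arguments.
Unset Strict Implicit.
Unset Printing Implicit Defensive.

Record category := Category {
  obj :> Type;
  hom : obj -> obj -> Type;
  idm : forall A, hom A A;
  compm : forall A B C, hom B C -> hom A B -> hom A C;
  compm1 : forall A B (f : hom A B), compm f (idm A) = f;
  comp1m : forall A B (f : hom A B), compm (idm B) f = f;
  compmA : forall A B C D (h : hom C D) (g : hom B C) (f : hom A B),
    compm h (compm g f) = compm (compm h g) f
}.

Arguments hom {c} A B.
Arguments idm {c} A.
Arguments compm {c A B C} g f.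

Declare Scope cat_scope.
Delimit Scope cat_scope with cat.
Notation "g '\c' f" := (compm g f) (at level 40, left associativity) : cat_scope.
Local Open Scope cat_scope.

Section Notions.
Variable C : category.

Definition mono (A B : C) (m : hom A B) : Prop :=
  forall Z (f g : hom Z A), m \c f = m \c g -> f = g.

Definition is_terminal (T : C) : Prop := forall A, exists! f : hom A T, True.
Definition is_initial (I : C) : Prop := forall A, exists! f : hom I A, True.
Definition is_zero (Z : C) : Prop := is_initial Z /\ is_terminal Z.

Definition is_product (A B P : C) (p : hom P A) (q : hom P B) : Prop :=
  forall Z (f : hom Z A) (g : hom Z B),
    exists! h : hom Z P, p \c h = f /\ q \c h = g.

Definition is_equalizer (A B K : C) (f g : hom A B) (e : hom K A) : Prop :=
  f \c e = g \c e /\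
  forall Z (h : hom Z A), f \c h = g \c h -> exists! k : hom Z K, e \c k = h.

Definition is_pullback (A B D P : C) (f : hom A D) (g : hom B D)
    (p : hom P A) (q : hom P B) : Prop :=
  f \c p = g \c q /\
  forall Z (a : hom Z A) (b : hom Z B), f \c a = g \c b ->
    exists! h : hom Z P, p \c h = a /\ q \c h = b.

Definition is_pushout (D A B P : C) (f : hom D A) (g : hom D B)
    (i : hom A P) (j : hom B P) : Prop :=
  i \c f = j \c g /\
  forall Z (a : hom A Z) (b : hom B Z), a \c f = b \c g ->
    exists! h : hom P Z, h \c i = a /\ h \c j = b.

Definition zero_morphism (A B : C) (f : hom A B) : Prop :=
  exists (Z : C) (a : hom A Z) (b : hom Z B), is_zero Z /\ f = b \c a.

Definition is_kernel (K A B : C) (w : hom A B) (u : hom K A) : Prop :=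
  zero_morphism (w \c u) /\
  forall Z (f : hom Z A), zero_morphism (w \c f) ->
    exists! g : hom Z K, u \c g = f.

Definition is_cokernel (A B Q : C) (u : hom A B) (w : hom B Q) : Prop :=
  zero_morphism (w \c u) /\
  forall Z (f : hom B Z), zero_morphism (f \c u) ->
    exists! g : hom Q Z, g \c w = f.

(* [E] is the exponential [B^A] with evaluation [ev], where [p] and [q] exhibit
   [P] as [E * A]; in the universal property, [h] is [g * id_A]. *)
Definition is_exponential (A B E P : C)
    (p : hom P E) (q : hom P A) (ev : hom P B) : Prop :=
  is_product p q /\
  forall Z Q (p' : hom Q Z) (q' : hom Q A), is_product p' q' ->
  forall f : hom Q B,
    exists! g : hom Z E,
      exists h : hom Q P, [/\ p \c h = g \c p', q \c h = q' & ev \c h = f].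

Definition is_subobject_classifier (one Omega : C) (true_ : hom one Omega) : Prop :=
  forall S A (m : hom S A), mono m ->
    exists! chi : hom A Omega,
      exists t : hom S one, is_pullback chi true_ m t.

Definition sub_le (A S T : C) (m : hom S A) (n : hom T A) : Prop :=
  exists h : hom S T, n \c h = m.

(* Complements in the poset of subobjects of [A]: the subobjects below both [m]
   and [n] are least, and those above both are greatest. *)
Definition is_complement (A S T : C) (m : hom S A) (n : hom T A) : Prop :=
  (forall R (r : hom R A), mono r -> sub_le r m -> sub_le r n ->
     forall U (k : hom U A), mono k -> sub_le r k) /\
  (forall R (r : hom R A), mono r -> sub_le m r -> sub_le n r ->
     forall U (k : hom U A), mono k -> sub_le k r).

End Notions.

(* A terminal object is chosen so that pointed objects can be defined; the
   remaining structure is only required to exist. Finite colimits are not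
   assumed. *)
Record elementary_topos := ElementaryTopos {
  topos_cat :> category;
  one : topos_cat;
  one_terminal : is_terminal one;
  topos_products : forall A B : topos_cat,
    exists (P : topos_cat) (p : hom P A) (q : hom P B), is_product p q;
  topos_equalizers : forall (A B : topos_cat) (f g : hom A B),
    exists (K : topos_cat) (e : hom K A), is_equalizer f g e;
  topos_exponentials : forall A B : topos_cat,
    exists (E P : topos_cat) (p : hom P E) (q : hom P A) (ev : hom P B),
      is_exponential p q ev;
  topos_classifier : exists (Omega : topos_cat) (true_ : hom one Omega),
    is_subobject_classifier true_
}.

Arguments one {e}.

(* The Heyting algebra of subobjects of every object is Boolean. *)
Definition boolean (E : elementary_topos) : Prop :=
  forall (A S : E) (m : hom S A), mono m ->
    exists (T : E) (n : hom T A), mono n /\ is_complement m n.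

Section Pointed.
Variable E : elementary_topos.

Record pointed_obj := PointedObj {
  carrier :> E;
  point : hom one carrier
}.

Definition pointed_hom (A B : pointed_obj) : Type :=
  {f : hom (carrier A) (carrier B) | f \c point A = point B}.

Lemma pointed_hom_eq (A B : pointed_obj) (f g : pointed_hom A B) :
  proj1_sig f = proj1_sig g -> f = g.
Proof.
by case: f g => f hf [g hg] /= e; subst g; rewrite (proof_irrelevance _ hf hg).
Qed.

Definition pointed_id (A : pointed_obj) : pointed_hom A A :=
  exist _ (idm (carrier A)) (comp1m (point A)).

Lemma pointed_comp_proof (A B D : pointed_obj)
    (g : pointed_hom B D) (f : pointed_hom A B) :
  (proj1_sig g \c proj1_sig f) \c point A = point D.
Proof. by rewrite -compmA (proj2_sig f) (proj2_sig g). Qed.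

Definition pointed_comp (A B D : pointed_obj)
    (g : pointed_hom B D) (f : pointed_hom A B) : pointed_hom A D :=
  exist _ (proj1_sig g \c proj1_sig f) (pointed_comp_proof g f).

Definition pointed : category.
Proof.
apply: (@Category pointed_obj pointed_hom pointed_id pointed_comp).
- by move=> A B f; apply: pointed_hom_eq; apply: compm1.
- by move=> A B f; apply: pointed_hom_eq; apply: comp1m.
- by move=> A B D F h g f; apply: pointed_hom_eq; apply: compmA.
Defined.

End Pointed.

Section Actions.
Variables (E : elementary_topos) (X : pointed E).

Record split_ses (G : pointed E) := SplitSes {
  ses_mid : pointed E;
  ses_u : hom G ses_mid;
  ses_v : hom ses_mid G;
  ses_w : hom ses_mid X;
  ses_kernel : is_kernel ses_w ses_u;
  ses_cokernel : is_cokernel ses_u ses_w;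
  ses_split : ses_v \c ses_u = idm G
}.

Definition ses_iso (G : pointed E) (a b : split_ses G) : Prop :=
  exists (th : hom (ses_mid a) (ses_mid b)) (th' : hom (ses_mid b) (ses_mid a)),
    [/\ th' \c th = idm _, th \c th' = idm _, th \c ses_u a = ses_u b,
        ses_v b \c th = ses_v a & ses_w b \c th = ses_w a].

Definition Act (G : pointed E) : Type :=
  {P : split_ses G -> Prop | exists a, P = ses_iso a}.

Definition act_class (G : pointed E) (a : split_ses G) : Act G :=
  exist _ (ses_iso a) (ex_intro _ a erefl).

Lemma act_class_surj (G : pointed E) (c : Act G) : exists a, c = act_class a.
Proof.
case: c => P hP; case: (hP) => a ea; exists a; subst P.
by rewrite /act_class; congr exist; apply: proof_irrelevance.
Qed.

Lemma ses_iso_refl (G : pointed E) (a : split_ses G) : ses_iso a a.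
Proof. by exists (idm _), (idm _); rewrite !comp1m !compm1. Qed.

Lemma ses_iso_sym (G : pointed E) (a b : split_ses G) :
  ses_iso a b -> ses_iso b a.
Proof.
move=> [t [t' [h1 h2 hu hv hw]]]; exists t', t; split=> //.
- by rewrite -hu compmA h1 comp1m.
- by rewrite -hv -compmA h2 compm1.
- by rewrite -hw -compmA h2 compm1.
Qed.

Lemma ses_iso_trans (G : pointed E) (a b c : split_ses G) :
  ses_iso a b -> ses_iso b c -> ses_iso a c.
Proof.
move=> [t [t' [h1 h2 hu hv hw]]] [r [r' [k1 k2 ku kv kw]]].
exists (r \c t), (t' \c r'); split.
- by rewrite -compmA (compmA r') k1 comp1m.
- by rewrite -compmA (compmA t) h2 comp1m.
- by rewrite -compmA hu.
- by rewrite compmA kv.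
- by rewrite compmA kw.
Qed.

Lemma act_class_eq (G : pointed E) (a b : split_ses G) :
  act_class a = act_class b <-> ses_iso a b.
Proof.
split=> [e | hab].
  have /= -> := f_equal (@proj1_sig _ _) e; exact: ses_iso_refl.
have e : ses_iso a = ses_iso b.
  apply: functional_extensionality => c; apply: propositional_extensionality.
  split; last exact: ses_iso_trans.
  by apply: ses_iso_trans; apply: ses_iso_sym.
rewrite /act_class; move: (ex_intro _ a _) (ex_intro _ b _).
by rewrite e => p q; congr exist; apply: proof_irrelevance.
Qed.

(* [b] is obtained by pushing out [a] along [s]: its middle object is the
   pushout, with coprojections [k] and [ses_u b]; the last two equations,
   together with [ses_split b] and [ses_kernel b], say that [ses_v b] is the
   induced map [(s v, id)] and [ses_w b] is the induced map [(w, 0)]. *)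
Definition ses_pushout (G G' : pointed E) (s : hom G G')
    (a : split_ses G) (b : split_ses G') : Prop :=
  exists k : hom (ses_mid a) (ses_mid b),
    [/\ is_pushout (ses_u a) s k (ses_u b),
        ses_v b \c k = s \c ses_v a
      & ses_w b \c k = ses_w a].

(* The graph of [Act(X, s) : Act(X, G) -> Act(X, G')]. *)
Definition act_map (G G' : pointed E) (s : hom G G')
    (c : Act G) (d : Act G') : Prop :=
  exists a b, [/\ c = act_class a, d = act_class b & ses_pushout s a b].

End Actions.

(* Main.v *)
Require Import Defs.
From mathcomp Require Import ssreflect ssrfun ssrbool.
From Stdlib Require Import IndefiniteDescription.

Set Implicit Arguments.
Unset Strict Implicit.
Unset Printing Implicit Defensive.

Local Open Scope cat_scope.

(** In pointed sets, a split exact sequence (u, v, w) from G to X exhibits its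
    middle object A as the disjoint union of G and X minus its point, because
    the cokernel of an inclusion collapses G and leaves the rest untouched.  So
    w has exactly one pointed section t, the pair (u, t) makes A the coproduct
    of G and X among pointed objects, and the only remaining datum is the
    retraction v, which on this coproduct is (id, v t).  The action is thus
    encoded by the map v t from X to G, and every map f arises: take the wedge
    of G and X with retraction (id, f).  Naturality holds because a pushout
    square preserves the sections t.

    To run this argument in a Boolean topos one has to know that a subobject
    and its complement form a coproduct, whereas the hypothesis only speaks of
    the lattice of subobjects and no finite colimits are given.  The whole
    topos-theoretic input is one construction, [forall_along]: universal
    quantification of a subobject along an arbitrary map, built from
    exponentials and the classifier.  It yields
    - stability under pullback of the two halves of complementarity, meeting in
      nothing and covering everything ([complement_decomposition]), hence
      arguments by cases on generalized elements;
    - subobjects given by an implication ([implication_exists]).  From these one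
      cuts out the graph of the map that glues two maps on complementary
      subobjects ([decomposition_copair]), and the wedge of G and X as a
      subobject of their product ([wedge_exists]).

    The pointed part then rests on [cokernel_section] (existence and uniqueness
    of t, and the coproduct property) and [wedge_exists]; what follows them is
    formal. *)

(** * Universal properties *)

Definition is_coproduct (C : category) (A B P : C) (i : hom A P) (j : hom B P) :
    Prop :=
  forall Z (f : hom A Z) (g : hom B Z),
    exists! h : hom P Z, h \c i = f /\ h \c j = g.

Lemma ex1_eq (T : Type) (P : T -> Prop) (x y : T) :
  (exists! z, P z) -> P x -> P y -> x = y.
Proof. by move=> [z [_ uz]] Px Py; rewrite -(uz x Px) (uz y Py). Qed.

Section Limits.
Variable C : category.

Lemma product_ext (A B P : C) (p : hom P A) (q : hom P B) :
  is_product p q -> forall Z (h k : hom Z P),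
  p \c h = p \c k -> q \c h = q \c k -> h = k.
Proof. by move=> pq Z h k ep eq; apply: (ex1_eq (pq Z (p \c k) (q \c k))). Qed.

Lemma coproduct_ext (A B P : C) (i : hom A P) (j : hom B P) :
  is_coproduct i j -> forall Z (h k : hom P Z),
  h \c i = k \c i -> h \c j = k \c j -> h = k.
Proof. by move=> ij Z h k ei ej; apply: (ex1_eq (ij Z (k \c i) (k \c j))). Qed.

Lemma equalizer_mono (A B K : C) (f g : hom A B) (e : hom K A) :
  is_equalizer f g e -> mono e.
Proof.
move=> [fg ue] Z h k ehk; apply: (ex1_eq (ue Z (e \c k) _)) => //.
by rewrite !compmA fg.
Qed.

Lemma cokernel_ext (A B Q : C) (u : hom A B) (w : hom B Q) :
  is_cokernel u w -> forall Z (h k : hom Q Z), h \c w = k \c w -> h = k.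
Proof.
move=> [[Z0 [a [b [zZ e]]]] uw] Z h k ehk.
apply: (ex1_eq (uw Z (k \c w) _)) => //.
by exists Z0, a, (k \c b); split=> //; rewrite -compmA e compmA.
Qed.

End Limits.

(** * Subobjects of a topos and generalized elements *)

Section Subobjects.
Variable E : elementary_topos.

Lemma to_one_eq (A : E) (f g : hom A one) : f = g.
Proof. exact: (ex1_eq (one_terminal A)). Qed.

Lemma point_mono (A : E) (x : hom one A) : mono x.
Proof. by move=> Z f g _; apply: to_one_eq. Qed.

Lemma sub_le_comp (A V W S : E) (m : hom S A) (a : hom W A) (v : hom V W) :
  sub_le a m -> sub_le (a \c v) m.
Proof. by move=> [h e]; exists (h \c v); rewrite compmA e. Qed.

Lemma intersection_exists (A S T : E) (m : hom S A) (n : hom T A) :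
  mono m -> mono n -> exists (R : E) (r : hom R A),
    mono r /\ forall V (a : hom V A), sub_le a r <-> sub_le a m /\ sub_le a n.
Proof.
move=> mm mn; case: (topos_products S T) => P [p [q pq]].
case: (topos_equalizers (m \c p) (n \c q)) => R [e he].
exists R, (m \c p \c e); split=> [Z f g efg | V a].
  apply: (equalizer_mono he); apply: (product_ext pq).
    by apply: mm; rewrite !compmA.
  by apply: mn; rewrite !compmA -he.1.
split=> [[h <-] | [[s es] [t et]]].
  split; first by exists (p \c e \c h); rewrite !compmA.
  by exists (q \c e \c h); rewrite !compmA -he.1.
case: (pq V s t) => c [[ps qt] _].
have [|h [eh _]] := he.2 V c; first by rewrite -!compmA ps qt es et.
by exists h; rewrite -!compmA eh ps.
Qed.

(** The subobject classified by chi is the set of generalized elements that chi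
    sends to true; uniqueness of characteristic maps turns equality of these
    sets into equality of maps. *)
Lemma classifier_ext (Omega : E) (true_ : hom one Omega) :
  is_subobject_classifier true_ ->
  forall (B : E) (chi psi : hom B Omega),
  (forall Z (z : hom Z B), sub_le (chi \c z) true_ <-> sub_le (psi \c z) true_) ->
  chi = psi.
Proof.
move=> cls B chi psi same.
case: (topos_products B one) => P [p [q pq]].
case: (topos_equalizers (chi \c p) (true_ \c q)) => K [e he].
have mK : mono (p \c e).
  move=> Z f g efg; apply: (equalizer_mono he); apply: (product_ext pq).
    by rewrite !compmA.
  exact: to_one_eq.
have pull (xi : hom B Omega) :
    (forall Z (z : hom Z B),
      sub_le (chi \c z) true_ <-> sub_le (xi \c z) true_) ->
    exists t, is_pullback xi true_ (p \c e) t.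
  move=> sx; have [|t et] := (sx K (p \c e)).1.
    by exists (q \c e); rewrite !compmA he.1.
  exists t; split=> [//|Z a b eab].
  have [|b' eb'] := (sx Z a).2; first by exists b.
  case: (pq Z a b') => c [[pc qc] _].
  have [|h [eh _]] := he.2 Z c; first by rewrite -!compmA pc qc.
  exists h; split.
    by split; [rewrite -compmA eh | exact: to_one_eq].
  by move=> h' [eh' _]; apply: mK; rewrite eh' -compmA eh.
exact: (ex1_eq (cls _ _ _ mK) (pull chi (fun _ _ => conj id id)) (pull psi same)).
Qed.

Lemma classifier_exists (Omega : E) (true_ : hom one Omega) :
  is_subobject_classifier true_ ->
  forall (S A : E) (m : hom S A), mono m -> exists chi : hom A Omega,
  forall Z (z : hom Z A), sub_le (chi \c z) true_ <-> sub_le z m.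
Proof.
move=> cls S A m mm; case: (cls S A m mm) => chi [[t [sq up]] _].
exists chi => Z z; split=> [[b eb] | [h <-]].
  by have [|h [[eh _] _]] := up Z z b; [| exists h].
by exists (t \c h); rewrite !compmA sq.
Qed.

(** The subobject k consists of those x in A such that all w in W over x belong
    to R.  Over A * W, the graph of a and its restriction to R have
    characteristic maps chi and psi; the condition on x says that chi and psi
    agree on the fibre over x, that is, that their transposes from A to
    Omega^W agree at x. *)
Lemma forall_along (W A R : E) (a : hom W A) (r : hom R W) :
  mono r -> exists (U : E) (k : hom U A), mono k /\
    forall V (x : hom V A), sub_le x k <->
      (forall Z (y : hom Z V) (w : hom Z W), x \c y = a \c w -> sub_le w r).
Proof.
move=> mr; case: (topos_classifier E) => Omega [true_ cls].
case: (topos_products A W) => Q [p' [q' pq']].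
case: (pq' W a (idm W)) => g [[pg qg] _].
have mg : mono g.
  by move=> Z f h e; rewrite -(comp1m f) -(comp1m h) -qg -!compmA e.
have mgr : mono (g \c r).
  by move=> Z f h e; apply: mr; apply: mg; rewrite !compmA.
case: (classifier_exists cls mg) => chi hchi.
case: (classifier_exists cls mgr) => psi hpsi.
case: (topos_exponentials W Omega) => X [P [p [q [ev [pq tr]]]]].
case: (tr A Q p' q' pq' chi) => c [[hc [phc qhc ec]] _].
case: (tr A Q p' q' pq' psi) => d [[hd [phd qhd ed]] _].
case: (topos_equalizers c d) => U [k hk].
exists U, k; split; first exact: equalizer_mono hk.
move=> V x; case: (topos_products V W) => Y [s [t st]].
case: (pq' Y (x \c s) t) => b [[pb qb] _].
have -> : sub_le x k <-> c \c x = d \c x.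
  split=> [[h <-] | e]; first by rewrite !compmA hk.1.
  by case: (hk.2 V x e) => h [eh _]; exists h.
have -> : c \c x = d \c x <-> chi \c b = psi \c b.
  split=> e.
    rewrite -ec -ed -!compmA; congr (_ \c _); apply: (product_ext pq).
      by rewrite !compmA phc phd -!compmA pb !compmA e.
    by rewrite !compmA qhc qhd.
  apply: (ex1_eq (tr V Y s t st (chi \c b))).
    exists (hc \c b); split; last by rewrite compmA ec.
      by rewrite compmA phc -!compmA pb.
    by rewrite compmA qhc.
  exists (hd \c b); split; last by rewrite compmA ed.
    by rewrite compmA phd -!compmA pb.
  by rewrite compmA qhd.
split=> [e Z y w exy | all].
  case: (st Z y w) => z [[sz tz] _].
  have ez : b \c z = g \c w.
    apply: (product_ext pq'); first by rewrite !compmA pb pg -exy -compmA sz.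
    by rewrite !compmA qb qg tz comp1m.
  have /hchi : sub_le (b \c z) g by exists w.
  rewrite compmA e -compmA => /hpsi [h eh].
  by exists h; apply: mg; rewrite compmA eh ez.
apply: (classifier_ext cls) => Z z; rewrite -!compmA; split.
  move=> /hchi [w ew]; apply/hpsi.
  have [|h eh] := all Z (s \c z) w.
    by rewrite compmA -pb -compmA -ew compmA pg.
  by exists h; rewrite -compmA eh.
move=> /hpsi [w ew]; apply/hchi.
by exists (r \c w); rewrite compmA.
Qed.

(** This captures that V is initial by its subobjects, without an initial object
    to compare it with: it makes parallel maps out of V agree, and it passes to
    every object over V. *)
Definition degenerate (V : E) : Prop :=
  forall R (r : hom R V), mono r -> sub_le (idm V) r.

Lemma degenerate_eq (V B : E) (f g : hom V B) : degenerate V -> f = g.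
Proof.
move=> dV; case: (topos_equalizers f g) => K [e he].
have [h eh] := dV K e (equalizer_mono he).
by rewrite -(compm1 f) -(compm1 g) -eh !compmA he.1.
Qed.

(** Quantifying along a turns a subobject of W into a subobject of V, which is
    everything. *)
Lemma degenerate_over (V W : E) (a : hom W V) : degenerate V -> degenerate W.
Proof.
move=> dV R r mr; have [U [k [mk hk]]] := forall_along a mr.
have ak : sub_le a k by rewrite -(comp1m a); apply: sub_le_comp; apply: dV.
by apply: ((hk W a).1 ak W (idm W)).
Qed.

(** [covers] and [disjoint] quantify over all generalized elements, which makes
    them stable under pullback by construction; this is what allows case
    distinctions in a varying context. *)
Definition covers (A S T : E) (m : hom S A) (n : hom T A) : Prop :=
  forall W (a : hom W A) R (r : hom R W), mono r ->
    (forall V (v : hom V W), sub_le (a \c v) m -> sub_le v r) ->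
    (forall V (v : hom V W), sub_le (a \c v) n -> sub_le v r) ->
    sub_le (idm W) r.

Definition disjoint (A S T : E) (m : hom S A) (n : hom T A) : Prop :=
  forall V (v : hom V A), sub_le v m -> sub_le v n -> degenerate V.

Definition decomposition (A S T : E) (m : hom S A) (n : hom T A) : Prop :=
  [/\ mono m, mono n, covers m n & disjoint m n].

(** The lattice-theoretic hypotheses concern subobjects of A alone.  To test a
    subobject r of an object W over A, quantify it along W -> A: the result is a
    subobject of A that contains both S and T.  Disjointness is similar: the
    intersection of S and T is a least subobject, hence degenerate. *)
Lemma complement_decomposition (A S T : E) (m : hom S A) (n : hom T A) :
  mono m -> mono n -> is_complement m n -> decomposition m n.
Proof.
move=> mm mn [bot top]; split=> //.
  move=> W a R r mr inS inT; have [U [k [mk hk]]] := forall_along a mr.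
  have [h eh] : sub_le (idm A) k.
    apply: (top U k mk) => [||Z f g]; last by rewrite !comp1m.
      apply/hk => Z y w e; apply: inS; rewrite -e; by exists y.
    apply/hk => Z y w e; apply: inT; rewrite -e; by exists y.
  have ak : sub_le a k by exists (h \c a); rewrite compmA eh comp1m.
  by apply: ((hk W a).1 ak W (idm W)).
move=> V v vm vn; have [R [r [mr hr]]] := intersection_exists mm mn.
have [h eh] : sub_le v r by apply/hr.
apply: (degenerate_over h) => U k mk.
have [rm rn] : sub_le r m /\ sub_le r n.
  by apply/hr; exists (idm R); rewrite compm1.
have [|l el] := bot R r mr rm rn _ (r \c k).
  by move=> Z f g e; apply: mk; apply: mr; rewrite !compmA.
by exists l; apply: mr; rewrite compm1 compmA.
Qed.

Lemma decomposition_preimage (A B S T S' T' : E) (f : hom B A)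
    (m : hom S A) (n : hom T A) (m' : hom S' B) (n' : hom T' B) :
  mono m' -> mono n' ->
  (forall V (b : hom V B), sub_le (f \c b) m <-> sub_le b m') ->
  (forall V (b : hom V B), sub_le (f \c b) n <-> sub_le b n') ->
  decomposition m n -> decomposition m' n'.
Proof.
move=> mm' mn' hm hn [_ _ cov dis]; split=> //.
  move=> W a R r mr inS inT; apply: (cov W (f \c a) R r mr) => V v.
    by rewrite -compmA => /hm; apply: inS.
  by rewrite -compmA => /hn; apply: inT.
by move=> V v /hm vm /hn vn; apply: dis vm vn.
Qed.

(** Two maps that agree on each part are equal, since their equalizer contains
    both parts. *)
Lemma decomposition_eq (A S T : E) (m : hom S A) (n : hom T A) :
  decomposition m n -> forall (W B : E) (a : hom W A) (f g : hom W B),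
  (forall V (v : hom V W), sub_le (a \c v) m -> f \c v = g \c v) ->
  (forall V (v : hom V W), sub_le (a \c v) n -> f \c v = g \c v) ->
  f = g.
Proof.
move=> [_ _ cov _] W B a f g eS eT.
case: (topos_equalizers f g) => K [e he].
have inK V (v : hom V W) : f \c v = g \c v -> sub_le v e.
  by move=> /he.2 [h [eh _]]; exists h.
have [|V v /eS|V v /eT|h eh] := cov W a K e; try exact: inK.
  exact: equalizer_mono he.
by rewrite -(compm1 f) -(compm1 g) -eh !compmA he.1.
Qed.

(** The subobject of those (a, z) for which a = m s implies z = f s, obtained by
    quantifying the graph of f in S * Z along m * Z. *)
Lemma implication_exists (A Z S : E) (m : hom S A) (f : hom S Z) (P : E)
    (p : hom P A) (q : hom P Z) :
  is_product p q -> exists (U : E) (k : hom U P), mono k /\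
    forall V (x : hom V P), sub_le x k <->
      (forall V' (y : hom V' V) (s : hom V' S),
         p \c x \c y = m \c s -> q \c x \c y = f \c s).
Proof.
move=> pq; case: (topos_products S Z) => Q [p' [q' pq']].
case: (pq' S (idm S) f) => g [[pg qg] _].
have mg : mono g.
  by move=> V c d e; rewrite -(comp1m c) -(comp1m d) -pg -!compmA e.
case: (pq Q (m \c p') q') => a [[pa qa] _].
have [U [k [mk hk]]] := forall_along a mg.
exists U, k; split=> // V x; rewrite hk; split=> all V' y.
  move=> s es; case: (pq' V' s (q \c x \c y)) => w [[pw qw] _].
  have [|h eh] := all V' y w.
    apply: (product_ext pq); rewrite !compmA.
      by rewrite pa -(compmA m) pw.
    by rewrite qa qw.
  by rewrite -qw -pw -eh (compmA q') (compmA p') qg pg comp1m.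
move=> w ew; exists (p' \c w); apply: (product_ext pq'); rewrite !compmA.
  by rewrite pg comp1m.
rewrite qg -compmA -(all V' y); first by rewrite -qa -!compmA ew.
by rewrite -(compmA p) ew !compmA pa.
Qed.

(** The graph of the glued map is the set R of pairs (a, z) such that z = f a if a
    is in S and z = g a if a is in T.  By cases on a, such a z is unique, so R is
    a subobject of A; it contains S and T, hence is all of A. *)
Lemma decomposition_copair (A S T : E) (m : hom S A) (n : hom T A) :
  decomposition m n -> forall (Z : E) (f : hom S Z) (g : hom T Z),
  exists h : hom A Z, h \c m = f /\ h \c n = g.
Proof.
move=> dec Z f g; case: (dec) => mm mn cov dis.
case: (topos_products A Z) => P [p [q pq]].
have [U [k [mk hk]]] := implication_exists m f pq.
have [U' [k' [mk' hk']]] := implication_exists n g pq.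
have [R [r [mr hr]]] := intersection_exists mk mk'.
have valR V (x : hom V P) : sub_le x r ->
    (forall s, p \c x = m \c s -> q \c x = f \c s) /\
    (forall t, p \c x = n \c t -> q \c x = g \c t).
  move=> /hr [/hk uf /hk' ug]; split=> [s es | t et].
    by have := uf V (idm V) s; rewrite !compm1; apply.
  by have := ug V (idm V) t; rewrite !compm1; apply.
have mpr : mono (p \c r).
  move=> W x y; rewrite -!compmA => exy.
  apply: mr; apply: (product_ext pq) => //.
  have rx V (v : hom V W) : sub_le (r \c x \c v) r.
    by exists (x \c v); rewrite compmA.
  have ry V (v : hom V W) : sub_le (r \c y \c v) r.
    by exists (y \c v); rewrite compmA.
  apply: (decomposition_eq dec (a := p \c (r \c x))) => V v [s es].
    rewrite -!compmA !(compmA r).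
    rewrite ((valR _ _ (rx V v)).1 s); last by rewrite compmA es.
    by rewrite ((valR _ _ (ry V v)).1 s) // compmA -exy es.
  rewrite -!compmA !(compmA r).
  rewrite ((valR _ _ (rx V v)).2 s); last by rewrite compmA es.
  by rewrite ((valR _ _ (ry V v)).2 s) // compmA -exy es.
case: (pq S m f) => xf [[pf qf] _]; case: (pq T n g) => xg [[pg qg] _].
have [rf erf] : sub_le xf r.
  apply/hr; split; [apply/hk | apply/hk'] => V y s.
    by rewrite pf qf => /mm ->.
  rewrite pf => e; apply: degenerate_eq; apply: (dis V (m \c y)); first by exists y.
  by rewrite e; exists s.
have [rg erg] : sub_le xg r.
  apply/hr; split; [apply/hk | apply/hk'] => V y s.
    rewrite pg => e; apply: degenerate_eq; apply: (dis V (n \c y)); last by exists y.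
    by rewrite e; exists s.
  by rewrite pg qg => /mn ->.
have [l el] : sub_le (idm A) (p \c r).
  apply: (cov A (idm A)) => // V v; rewrite comp1m => -[s <-].
    by exists (rf \c s); rewrite compmA -(compmA p) erf pf.
  by exists (rg \c s); rewrite compmA -(compmA p) erg pg.
exists (q \c r \c l); split.
  have -> : q \c r \c l \c m = q \c r \c (l \c m) by rewrite -!compmA.
  have -> : l \c m = rf by apply: mpr; rewrite compmA el comp1m -compmA erf pf.
  by rewrite -compmA erf qf.
have -> : q \c r \c l \c n = q \c r \c (l \c n) by rewrite -!compmA.
have -> : l \c n = rg by apply: mpr; rewrite compmA el comp1m -compmA erg pg.
by rewrite -compmA erg qg.
Qed.

End Subobjects.

(** * Exact sequences of pointed objects *)

Section PointedObjects.
Variable E : elementary_topos.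
Implicit Types A B D G X Z : pointed E.

Definition underlying A B (f : hom A B) : hom (carrier A) (carrier B) :=
  proj1_sig f.

Local Notation "⌊ f ⌋" := (underlying f) (at level 0).

Lemma underlying_comp A B D (g : hom B D) (f : hom A B) :
  ⌊g \c f⌋ = ⌊g⌋ \c ⌊f⌋.
Proof. by []. Qed.

Lemma underlying_id A : ⌊idm A⌋ = idm (carrier A).
Proof. by []. Qed.

Lemma underlying_point A B (f : hom A B) : ⌊f⌋ \c point A = point B.
Proof. exact: (proj2_sig f). Qed.

Lemma underlying_inj A B (f g : hom A B) : ⌊f⌋ = ⌊g⌋ -> f = g.
Proof. exact: pointed_hom_eq. Qed.

Lemma lift_pointed A B (f : hom (carrier A) (carrier B)) :
  f \c point A = point B -> exists g : hom A B, ⌊g⌋ = f.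
Proof. by move=> e; exists (exist _ f e). Qed.

Definition terminal_pointed : pointed E := PointedObj (idm one).

Lemma terminal_pointed_zero : is_zero terminal_pointed.
Proof.
split=> A.
  have [g eg] : exists g : hom terminal_pointed A, ⌊g⌋ = point A.
    by apply: lift_pointed; rewrite compm1.
  exists g; split=> // h _; apply: underlying_inj.
  by rewrite eg -(underlying_point h) compm1.
case: (one_terminal (carrier A)) => t _.
have [|g eg] := @lift_pointed A terminal_pointed t; first exact: to_one_eq.
by exists g; split=> // h _; apply: underlying_inj; apply: to_one_eq.
Qed.

(** Zero objects are isomorphic to the terminal object, so a zero morphism is one
    that is constant at the base point. *)
Lemma zero_morphismP A B (f : hom A B) :
  zero_morphism f <-> sub_le ⌊f⌋ (point B).
Proof.
have [iO tO] := terminal_pointed_zero.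
split=> [[Z [a [b [[_ tZ] ->]]]] | [t et]].
  case: (iO Z) => z [_ _]; case: (tO Z) => z' [_ _].
  have -> : b = b \c (z \c z').
    by rewrite -[LHS]compm1; congr (_ \c _); apply: (ex1_eq (tZ Z)).
  exists (⌊z'⌋ \c ⌊a⌋).
  by rewrite -(underlying_point (b \c z)) !underlying_comp compm1 !compmA.
case: (iO B) => b _; case: (tO A) => a _.
exists terminal_pointed, a, b; split=> //; apply: underlying_inj.
rewrite -et underlying_comp -(underlying_point b) compm1.
by congr (_ \c _); apply: to_one_eq.
Qed.

Lemma zero_morphism_eq A B (f g : hom A B) :
  zero_morphism f -> zero_morphism g -> f = g.
Proof.
move=> /zero_morphismP [s es] /zero_morphismP [t et]; apply: underlying_inj.
by rewrite -es -et; congr (_ \c _); apply: to_one_eq.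
Qed.

Lemma zero_comp A B D (g : hom B D) (f : hom A B) :
  zero_morphism f -> zero_morphism (g \c f).
Proof.
by move=> [Z [a [b [zZ ->]]]]; exists Z, a, (g \c b); rewrite compmA.
Qed.

Lemma comp_zero A B D (g : hom B D) (f : hom A B) :
  zero_morphism g -> zero_morphism (g \c f).
Proof.
by move=> [Z [a [b [zZ ->]]]]; exists Z, (a \c f), b; rewrite compmA.
Qed.

Lemma zero_exists A B : exists f : hom A B, zero_morphism f.
Proof.
have [iO tO] := terminal_pointed_zero.
case: (iO B) => b _; case: (tO A) => a _.
by exists (b \c a), terminal_pointed, a, b.
Qed.

Hypothesis E_boolean : boolean E.

Lemma mono_decomposition (A S : E) (m : hom S A) :
  mono m -> exists (T : E) (n : hom T A), decomposition m n.
Proof.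
move=> mm; have [T [n [mn cmn]]] := E_boolean mm.
by exists T, n; apply: complement_decomposition.
Qed.

(** Let T be the complement of G in A.  The endomorphism e of A that is zero on G
    and the identity on T factors through the cokernel as e = t w, which gives
    the section.  An element of A is therefore either in G or equal to its image
    under t w; all three claims follow by cases. *)
Lemma cokernel_section G A X (u : hom G A) (w : hom A X) :
  mono ⌊u⌋ -> is_cokernel u w ->
  exists t : hom X A, [/\ w \c t = idm X, is_coproduct u t
    & forall t' : hom X A, w \c t' = idm X -> t' = t].
Proof.
move=> mu cw; have [zwu uw] := cw.
have [T [n dec]] := mono_decomposition mu.
have [z zz] := zero_exists G A.
have [e0 [e0u e0n]] := decomposition_copair dec ⌊z⌋ n.
have [|e ee] := @lift_pointed A A e0.
  by rewrite -{1}(underlying_point u) compmA e0u underlying_point.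
have eu : e \c u = z by apply: underlying_inj; rewrite underlying_comp ee e0u.
have en : ⌊e⌋ \c n = n by rewrite ee e0n.
case: (uw A e) => [|t [tw _]]; first by rewrite eu.
have wt : w \c t = idm X.
  apply: (cokernel_ext cw); rewrite -compmA tw comp1m.
  apply: underlying_inj; apply: (decomposition_eq dec (a := idm _)) => V v.
    rewrite comp1m => -[g <-]; rewrite !compmA; congr (_ \c g).
    rewrite -!underlying_comp; congr (⌊_⌋); apply: zero_morphism_eq => //.
    by rewrite -compmA eu; apply: zero_comp.
  rewrite comp1m => -[s <-]; rewrite underlying_comp.
  by rewrite -!compmA (compmA ⌊e⌋) en.
exists t; split=> // [Z p q | t' wt'].
  have [h0 [h0u h0n]] := decomposition_copair dec ⌊p⌋ (⌊q \c w⌋ \c n).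
  have [|h eh] := @lift_pointed A Z h0.
    by rewrite -(underlying_point u) compmA h0u underlying_point.
  exists h; split.
    split; first by apply: underlying_inj; rewrite underlying_comp eh h0u.
    apply: (cokernel_ext cw); rewrite -compmA tw.
    apply: underlying_inj; apply: (decomposition_eq dec (a := idm _)) => V v.
      rewrite comp1m => -[g <-]; rewrite !compmA; congr (_ \c g).
      rewrite -!underlying_comp; congr (⌊_⌋); apply: zero_morphism_eq.
        by rewrite -compmA eu; apply: zero_comp.
      by rewrite -compmA; apply: zero_comp.
    rewrite comp1m => -[s <-]; rewrite underlying_comp.
    by rewrite -!compmA (compmA ⌊e⌋) en !compmA eh h0n.
  move=> h' [h'u h't]; apply: underlying_inj.
  apply: (decomposition_eq dec (a := idm _)) => V v.
    rewrite comp1m => -[g <-]; rewrite !compmA; congr (_ \c g).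
    by rewrite eh h0u -h'u.
  rewrite comp1m => -[s <-]; rewrite !compmA; congr (_ \c s).
  by rewrite eh h0n -h't -compmA tw underlying_comp -compmA en.
(* where t' takes values in G, the argument is the base point *)
apply: underlying_inj.
apply: (decomposition_eq dec (a := ⌊t'⌋)) => V v [g eg].
  have /zero_morphismP [c ec] := zwu.
  have ev : v = point X \c (c \c g).
    rewrite compmA ec underlying_comp -compmA eg compmA -underlying_comp wt'.
    by rewrite underlying_id comp1m.
  by rewrite ev !(compmA _ (point X)) !underlying_point.
(* where t' takes values in T, they are fixed by e = t w *)
have ev : v = ⌊w⌋ \c n \c g.
  by rewrite -compmA eg compmA -underlying_comp wt' comp1m.
by rewrite {2}ev !compmA -underlying_comp tw en eg.
Qed.

(** The wedge is the subobject of X * G of those (x, g) such that g is the base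
    point as soon as x lies in the complement T of the base point of X.  Pulling
    back the decomposition of X into its point and T decomposes the wedge into G
    and T, so maps out of it can be glued; a pointed map on X is determined by
    its restriction to T. *)
Lemma wedge_exists G X :
  exists (P : pointed E) (i : hom G P) (j : hom X P) (w : hom P X),
    [/\ is_coproduct i j, is_kernel w i & w \c j = idm X].
Proof.
have [T [n dec]] := mono_decomposition (point_mono (x := point X)).
case: (dec) => _ mn _ dis.
case: (topos_products (carrier X) (carrier G)) => Q [p [q pq]].
case: (one_terminal T) => T1 _; case: (one_terminal (carrier G)) => G1 _.
case: (one_terminal (carrier X)) => X1 _.
have [U [k [mk hk]]] := implication_exists n (point G \c T1) pq.
case: (pq _ (point X) (point G)) => x0 [[px0 qx0] _].
case: (pq _ (point X \c G1) (idm (carrier G))) => x1 [[px1 qx1] _].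
case: (pq _ (idm (carrier X)) (point G \c X1)) => x2 [[px2 qx2] _].
have [u0 ku0] : sub_le x0 k.
  apply/hk => V y s _; rewrite qx0 -!compmA; congr (_ \c _); exact: to_one_eq.
have [u1 ku1] : sub_le x1 k.
  apply/hk => V y s; rewrite px1 => e; apply: degenerate_eq.
  by apply: (dis V (n \c s)); [exists (G1 \c y); rewrite compmA | exists s].
have [u2 ku2] : sub_le x2 k.
  apply/hk => V y s _; rewrite qx2 -!compmA; congr (_ \c _); exact: to_one_eq.
pose P : pointed E := PointedObj u0.
have [|i ei] := @lift_pointed G P u1.
  apply: mk; rewrite compmA ku1 ku0; apply: (product_ext pq); rewrite compmA.
    by rewrite px1 px0 -compmA (to_one_eq (G1 \c _) (idm one)) compm1.
  by rewrite qx1 qx0 comp1m.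
have [|j ej] := @lift_pointed X P u2.
  apply: mk; rewrite compmA ku2 ku0; apply: (product_ext pq); rewrite compmA.
    by rewrite px2 px0 comp1m.
  by rewrite qx2 qx0 -compmA (to_one_eq (X1 \c _) (idm one)) compm1.
have [|w ew] := @lift_pointed P X (p \c k); first by rewrite -compmA ku0.
have [|r er] := @lift_pointed P G (q \c k); first by rewrite -compmA ku0.
have wi : ⌊w⌋ \c ⌊i⌋ = point X \c G1 by rewrite ew ei -compmA ku1 px1.
have ri : ⌊r⌋ \c ⌊i⌋ = idm (carrier G) by rewrite er ei -compmA ku1 qx1.
have wj : ⌊w⌋ \c ⌊j⌋ = idm (carrier X) by rewrite ew ej -compmA ku2 px2.
have rj : ⌊r⌋ \c ⌊j⌋ = point G \c X1 by rewrite er ej -compmA ku2 qx2.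
have joint (V : E) (x y : hom V (carrier P)) :
    ⌊w⌋ \c x = ⌊w⌋ \c y -> ⌊r⌋ \c x = ⌊r⌋ \c y -> x = y.
  rewrite ew er -!compmA => ep eq.
  by apply: mk; apply: (product_ext pq); rewrite ?ep ?eq.
(* over the base point of X the wedge is the axis G, over T it is the axis X *)
have onG (V : E) (x : hom V (carrier P)) (c : hom V one) :
    ⌊w⌋ \c x = point X \c c -> x = ⌊i⌋ \c (⌊r⌋ \c x).
  move=> e; apply: joint; rewrite compmA; last by rewrite ri comp1m.
  by rewrite wi e -compmA; congr (_ \c _); apply: to_one_eq.
have onX (V : E) (x : hom V (carrier P)) (s : hom V T) :
    ⌊w⌋ \c x = n \c s -> x = ⌊j⌋ \c n \c s.
  move=> e; apply: joint; rewrite -compmA compmA ?wj ?rj ?comp1m //.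
  have /hk/(_ V (idm V) s) : sub_le (k \c x) k by exists x.
  rewrite !compm1 !compmA -ew -er => /(_ e) ->.
  by rewrite -!compmA; congr (_ \c _); apply: to_one_eq.
have zwi : zero_morphism (w \c i) by apply/zero_morphismP; exists G1.
have idwj : w \c j = idm X by apply: underlying_inj.
exists P, i, j, w; split=> //.
  have dec' : decomposition ⌊i⌋ (⌊j⌋ \c n).
    apply: (decomposition_preimage (f := ⌊w⌋) _ _ _ _ dec).
    - move=> V f g e; by rewrite -(comp1m f) -(comp1m g) -ri -!compmA e.
    - move=> V f g e; apply: mn; rewrite -(comp1m n) -wj -!compmA (compmA ⌊j⌋) e.
      by rewrite !compmA.
    - move=> V b; split=> [[c ec] | [g <-]].
        by exists (⌊r⌋ \c b); apply/esym; apply: (onG _ _ c).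
      rewrite compmA -underlying_comp; apply: sub_le_comp.
      exact/zero_morphismP.
    - move=> V b; split=> [[s es] | [s <-]].
        by exists s; apply/esym; apply: onX.
      by exists s; rewrite !compmA wj comp1m.
  move=> Z f g.
  have [h0 [h0i h0j]] := decomposition_copair dec' ⌊f⌋ (⌊g⌋ \c n).
  have [|h eh] := @lift_pointed P Z h0.
    by rewrite -(underlying_point i) compmA h0i underlying_point.
  exists h; split.
    split; apply: underlying_inj; rewrite underlying_comp eh //.
    apply: (decomposition_eq dec (a := idm _)) => V v.
      rewrite comp1m => -[c <-]; rewrite !compmA; congr (_ \c c).
      by rewrite -eh -underlying_comp !underlying_point.
    by rewrite comp1m => -[s <-]; rewrite compmA -(compmA h0) h0j compmA.
  move=> h' [h'i h'j]; apply: underlying_inj.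
  apply: (decomposition_eq dec' (a := idm _)) => V v.
    rewrite comp1m => -[s <-]; rewrite !compmA; congr (_ \c s).
    by rewrite eh h0i -h'i.
  rewrite comp1m => -[s <-]; rewrite !(compmA _ _ s); congr (_ \c s).
  by rewrite eh h0j -h'j compmA.
split=> // Z f /zero_morphismP [c /esym /onG ef].
exists (r \c f); split; first by apply: underlying_inj.
by move=> g <-; apply: underlying_inj; rewrite !underlying_comp compmA ri comp1m.
Qed.

End PointedObjects.

(** * Actions and maps *)

Section Classification.
Variables (E : elementary_topos) (X : pointed E).
Implicit Types G : pointed E.
Hypothesis E_boolean : boolean E.

(** This is a relation because the section t is only known to exist. *)
Definition classifies G (a : split_ses X G) (f : hom X G) : Prop :=
  exists t : hom X (ses_mid a), ses_w a \c t = idm X /\ ses_v a \c t = f.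

Lemma ses_section G (a : split_ses X G) :
  exists t : hom X (ses_mid a),
    [/\ ses_w a \c t = idm X, is_coproduct (ses_u a) t
      & forall t' : hom X (ses_mid a), ses_w a \c t' = idm X -> t' = t].
Proof.
apply: (cokernel_section E_boolean) (ses_cokernel a) => Z f g e.
rewrite -(comp1m f) -(comp1m g) -underlying_id -(ses_split a).
by rewrite underlying_comp -!compmA e.
Qed.

Lemma classifies_total G (a : split_ses X G) : exists f, classifies a f.
Proof.
by have [t [wt _ _]] := ses_section a; exists (ses_v a \c t), t.
Qed.

Lemma classifies_unique G (a : split_ses X G) f g :
  classifies a f -> classifies a g -> f = g.
Proof.
have [t [_ _ ut]] := ses_section a.
by move=> [s [/ut -> <-]] [s' [/ut -> <-]].
Qed.

Lemma classifies_surj G (f : hom X G) : exists a, classifies a f.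
Proof.
have [P [i [j [w [ij ker wj]]]]] := wedge_exists E_boolean G X.
have cok : is_cokernel i w.
  split=> [|Z g zg]; first by case: ker.
  exists (g \c j); split; last by move=> h <-; rewrite -compmA wj compm1.
  apply: (coproduct_ext ij); last by rewrite -!compmA wj compm1.
  by apply: zero_morphism_eq => //; rewrite -compmA; apply: zero_comp; case: ker.
case: (ij G (idm G) f) => v [[vi vj] _].
by exists (SplitSes ker cok vi), j.
Qed.

(** Both middle objects being coproducts, k is induced by s on G and by the
    identity on X; the square is a pushout because only the summand G
    changes. *)
Lemma ses_pushout_morphism G G' (s : hom G G') (a : split_ses X G)
    (b : split_ses X G') (f : hom X G) :
  classifies a f -> classifies b (s \c f) ->
  exists k : hom (ses_mid a) (ses_mid b), [/\ k \c ses_u a = ses_u b \c s,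
    ses_v b \c k = s \c ses_v a, ses_w b \c k = ses_w a
    & is_pushout (ses_u a) s k (ses_u b)].
Proof.
move=> [t [wt vt]] [t' [wt' vt']].
have [t0 [_ cop /(_ t wt) et]] := ses_section a; subst t0.
have [t0 [_ cop' /(_ t' wt') et']] := ses_section b; subst t0.
case: (cop _ (ses_u b \c s) t') => k [[ku kt] _].
exists k; split=> //.
- apply: (coproduct_ext cop); last by rewrite -!compmA kt vt' vt.
  by rewrite -!compmA ku compmA !ses_split comp1m compm1.
- apply: (coproduct_ext cop); last by rewrite -compmA kt wt' wt.
  apply: zero_morphism_eq; last by case: (ses_kernel a).
  rewrite -compmA ku compmA; apply: comp_zero; by case: (ses_kernel b).
split=> // Z p q epq; case: (cop' Z q (p \c t)) => h [[hu ht] _].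
exists h; split.
  split=> //; apply: (coproduct_ext cop); last by rewrite -compmA kt.
  by rewrite -compmA ku compmA hu.
move=> h' [h'k h'u]; apply: (coproduct_ext cop'); first by rewrite hu.
by rewrite ht -h'k -compmA kt.
Qed.

(** The comparison maps over the identity of G exist in both directions, and an
    endomorphism over G and X of a split exact sequence is the identity, since it
    preserves the unique section. *)
Lemma classifies_iso G (a b : split_ses X G) f :
  classifies a f -> classifies b f -> ses_iso a b.
Proof.
move=> af bf.
have map (c d : split_ses X G) : classifies c f -> classifies d f ->
    exists k : hom (ses_mid c) (ses_mid d), [/\ k \c ses_u c = ses_u d,
      ses_v d \c k = ses_v c & ses_w d \c k = ses_w c].
  move=> cf df; have := @ses_pushout_morphism _ _ (idm G) c d f cf.
  by rewrite comp1m => /(_ df) [k]; rewrite compm1 comp1m => -[]; exists k.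
have endo (c : split_ses X G) (e : hom (ses_mid c) (ses_mid c)) :
    e \c ses_u c = ses_u c -> ses_w c \c e = ses_w c -> e = idm _.
  move=> eu we; have [s [ws cs us]] := ses_section c.
  apply: (coproduct_ext cs); rewrite comp1m //.
  by apply: us; rewrite compmA we.
have [k [ku kv kw]] := map a b af bf; have [l [lu lv lw]] := map b a bf af.
exists k, l; split=> //; apply: endo.
- by rewrite -compmA ku.
- by rewrite compmA lw.
- by rewrite -compmA lu.
- by rewrite compmA kw.
Qed.

Lemma iso_classifies G (a b : split_ses X G) f :
  ses_iso a b -> classifies a f -> classifies b f.
Proof.
move=> [k [_ [_ _ _ vk wk]]] [t [wt vt]]; exists (k \c t).
by rewrite !compmA vk wk.
Qed.

Lemma pushout_classifies G G' (s : hom G G') (a : split_ses X G)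
    (b : split_ses X G') f :
  ses_pushout s a b -> classifies a f -> classifies b (s \c f).
Proof.
move=> [k [_ vk wk]] [t [wt vt]]; exists (k \c t).
by rewrite !compmA vk wk -compmA vt.
Qed.

(** The map is the same for all representatives, so that it can be chosen as a
    function of the class. *)
Lemma classifying_map_exists G (c : Act X G) :
  exists f, forall a, c = act_class a -> classifies a f.
Proof.
have [a ea] := act_class_surj c; have [f af] := classifies_total a.
exists f => b eb; apply: iso_classifies af.
by apply/act_class_eq; rewrite -ea -eb.
Qed.

End Classification.

Theorem corollary7 (E : elementary_topos) (E_boolean : boolean E)
    (X : pointed E) :
  (forall (G G' : pointed E) (s : hom G G') (c : Act X G),
     exists! d : Act X G', act_map s c d) /\
  exists phi : forall G : pointed E, Act X G -> hom X G,
    (forall G : pointed E, bijective (phi G)) /\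
    (forall (G G' : pointed E) (s : hom G G') (c : Act X G) (d : Act X G'),
       act_map s c d -> phi G' d = s \c phi G c).
Proof.
split=> [G G' s c |].
  have [a ea] := act_class_surj c.
  have [f af] := classifies_total E_boolean a.
  have [b bsf] := classifies_surj E_boolean (s \c f).
  exists (act_class b); split.
    have [k [_ kv kw po]] := ses_pushout_morphism E_boolean af bsf.
    by exists a, b; split=> //; exists k.
  move=> d [a' [b' [ea' -> po]]]; apply/act_class_eq.
  apply: (classifies_iso E_boolean bsf); apply: (pushout_classifies po).
  by apply: iso_classifies af; apply/act_class_eq; rewrite -ea.
pose choice G (c : Act X G) :=
  constructive_indefinite_description _ (classifying_map_exists E_boolean c).
pose phi G (c : Act X G) : hom X G := proj1_sig (choice G c).
have phiP G (a : split_ses X G) : classifies a (phi G (act_class a)).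
  exact: (proj2_sig (choice G (act_class a)) a erefl).
exists phi; split=> [G | G G' s c d [a [b [-> -> po]]]].
  have inv (f : hom X G) :=
    constructive_indefinite_description _ (classifies_surj E_boolean f).
  exists (fun f => act_class (proj1_sig (inv f))) => [c | f].
    have [a ->] := act_class_surj c; apply/act_class_eq.
    by apply: (classifies_iso E_boolean (proj2_sig (inv _))); apply: phiP.
  exact: (classifies_unique E_boolean (phiP G _) (proj2_sig (inv f))).
apply: (classifies_unique E_boolean (phiP G' b)).
exact: pushout_classifies po (phiP G a).
Qed.
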